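(* Let $q$ be a prime power, $r,n,h$ positive integers with $h\le r-1$, and let $L_U$ be an $h$-scattered $\mathbb{F}_q$-linear set of rank $\frac{rn}{h+1}$ in $\Omega=\mathrm{PG}(r-1,q^n)$. For every hyperplane $\mathcal{H}$ of $\Omega$, we have $$|\mathcal{H}\cap L_U| \in \left\{ \theta_{\frac{rn}{h+1}-n-1},\ldots,\theta_{\frac{rn}{h+1}-n+h-1} \right\}.$$ For every $i\in\{0,\ldots,h\}$, the number of hyperplanes $\mathcal{H}$ of $\Omega$ satisfying $|\mathcal{H}\cap L_U|=\theta_{\frac{rn}{h+1}-n+i-1}$ is $$t_i=\frac{1}{q^n-1}{n \brack i}_q \sum_{j=0}^{h-i} (-1)^{j}{n-i \brack j}_q q^{\binom{j}{2}}\left(q^{\frac{rn(h-i-j+1)}{h+1}}-1\right).$$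
   Context: For an integer $m\ge -1$, $\theta_m=\frac{q^{m+1}-1}{q-1}$ (so $\theta_{-1}=0$). Let $V$ be an $r$-dimensional $\mathbb{F}_{q^n}$-vector space and $\Omega=\mathrm{PG}(V,\mathbb{F}_{q^n})=\mathrm{PG}(r-1,q^n)$. For a $k$-dimensional $\mathbb{F}_q$-subspace $U$ of $V$, the $\mathbb{F}_q$-linear set of rank $k$ defined by $U$ is the point set $L_U=\{\langle\mathbf u\rangle_{\mathbb{F}_{q^n}}:\mathbf u\in U\setminus\{\mathbf 0\}\}$. For a positive integer $h\le r-1$, $U$ (and $L_U$) is $h$-scattered if $\langle U\rangle_{\mathbb{F}_{q^n}}=V$ and $\dim_{\mathbb{F}_q}(U\cap H)\le h$ for every $h$-dimensional $\mathbb{F}_{q^n}$-subspace $H$ of $V$. The $q$-binomial coefficient ${s\brack t}_q$ is $0$ if $s<0$ or $t<0$ or $t>s$, is $1$ if $t=0$ and $s\ge 0$, and is $\prod_{i=1}^t\frac{q^{s-i+1}-1}{q^i-1}$ otherwise. *)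

(* Defs.v *)
From HB Require Import structures.
From mathcomp Require Import all_boot all_order all_algebra all_field.

Set Implicit Arguments.
Unset Strict Implicit.
Unset Printing Implicit Defensive.

Import Order.TTheory GRing.Theory Num.Theory.
Local Open Scope ring_scope.

(* The carrier of the L-space V, seen as a vector space over F. The alias keeps
   the F-structure and the L-structure apart: F-subspaces have type
   {vspace restrict_scalars V}, L-subspaces have type {vspace V}. *)
Definition restrict_scalars (F : fieldType) (L : fieldExtType F)
  (V : vectType L) : predArgType := V.

Section RestrictScalars.
Variables (F : fieldType) (L : fieldExtType F) (V : vectType L).
Local Notation VF := (restrict_scalars V).

HB.instance Definition _ := GRing.Zmodule.on VF.

Definition restrict_scale (a : F) (v : VF) : VF := (a%:A : L) *: (v : V).

Fact restrict_scaleA a b v :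
  restrict_scale a (restrict_scale b v) = restrict_scale (a * b) v.
Proof. by rewrite /restrict_scale scalerA -scalerAl mul1r scalerA. Qed.

Fact restrict_scale1 : left_id 1 restrict_scale.
Proof. by move=> v; rewrite /restrict_scale !scale1r. Qed.

Fact restrict_scaleDr : right_distributive restrict_scale +%R.
Proof. by move=> a u v; rewrite /restrict_scale scalerDr. Qed.

Fact restrict_scaleDl v : {morph restrict_scale^~ v : a b / a + b}.
Proof. by move=> a b; rewrite /restrict_scale !scalerDl. Qed.

HB.instance Definition _ := GRing.Zmodule_isLmodule.Build F VF
  restrict_scaleA restrict_scale1 restrict_scaleDr restrict_scaleDl.

Lemma restrict_scaleE (a : F) (v : VF) : a *: v = (a%:A : L) *: (v : V) :> V.
Proof. by []. Qed.

Let coords (v : VF) : 'rV[F]_(\dim {:V} * \dim {:L}) :=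
  mxvec (\matrix_(i, j) coord (vbasis {:L}) j (coord (vbasis {:V}) i (v : V))).

Fact restrict_scalars_vect_axiom :
  Vector.axiom (\dim {:V} * \dim {:L}) VF.
Proof.
exists coords => [a u v|].
  rewrite /coords -linearP; congr mxvec; apply/matrixP=> i j; rewrite !mxE.
  have -> : coord (vbasis {:V}) i (a *: u + v : VF) =
    a *: coord (vbasis {:V}) i (u : V) + coord (vbasis {:V}) i (v : V) :> L.
    rewrite (_ : (a *: u + v : VF) = (a%:A : L) *: (u : V) + (v : V)) //.
    by rewrite linearP /= -scalerAl mul1r.
  by rewrite linearP.
exists (fun w : 'rV[F]_(\dim {:V} * \dim {:L}) => (\sum_i
  (\sum_j vec_mx w i j *: (vbasis {:L})`_j : L) *: (vbasis {:V})`_i : V)).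
  move=> v; rewrite /coords mxvecK [RHS](coord_vbasis (memvf (v : V))).
  apply: eq_bigr => i _; congr (_ *: _).
  rewrite [RHS](coord_vbasis (memvf _)); apply: eq_bigr => j _.
  by rewrite !mxE.
move=> w; rewrite /coords -[RHS]vec_mxK; congr mxvec; apply/matrixP=> i j.
by rewrite [LHS]mxE !coord_sum_free ?(basis_free (vbasisP _)).
Qed.

HB.instance Definition _ := Lmodule_hasFinDim.Build F VF
  restrict_scalars_vect_axiom.

Definition restrict_vs (H : {vspace V}) : {vspace VF} :=
  <<[seq (a *: v : V) : VF | a <- vbasis {:L}, v <- vbasis H]>>%VS.

Lemma mem_restrict_vs (H : {vspace V}) (v : V) :
  ((v : VF) \in restrict_vs H) = (v \in H).
Proof.
apply/idP/idP => [|vH]; last first.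
  rewrite (coord_vbasis vH).
  apply: (@rpred_sum VF) => i _; rewrite (coord_vbasis (memvf (coord _ i v))).
  rewrite scaler_suml; apply: (@rpred_sum VF) => j _.
  set a := coord _ j _.
  have -> : (a *: (vbasis {:L})`_j) *: (vbasis H)`_i =
    a *: ((vbasis {:L})`_j *: (vbasis H)`_i : VF) :> V.
    by rewrite restrict_scaleE scalerA -scalerAl mul1r.
  apply: rpredZ; apply/memv_span/allpairsP.
  by exists ((vbasis {:L})`_j, (vbasis H)`_i); rewrite !mem_nth ?size_tuple.
have sub x : x \in [seq (a *: w : V) : VF | a <- vbasis {:L}, w <- vbasis H]
    -> (x : V) \in H.
  by case/allpairsP=> [[a w] /= [_ wH ->]]; rewrite rpredZ // (vbasis_mem wH).
move=> /(@coord_span _ _ _ (in_tuple _)) ->.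
apply: (@rpred_sum V) => i _; rewrite restrict_scaleE rpredZ //.
by apply: sub; rewrite mem_nth.
Qed.

Definition extend_span (U : {vspace VF}) : {vspace V} :=
  <<(vbasis U : seq VF) : seq V>>%VS.

Lemma extend_span_subP (U : {vspace VF}) (W : {vspace V}) :
  reflect (forall u : V, (u : VF) \in U -> u \in W) (extend_span U <= W)%VS.
Proof.
apply: (iffP span_subvP) => [sUW u uU | sUW u uU]; last first.
  by apply: sUW; apply: vbasis_mem.
rewrite (coord_vbasis uU); apply: (@rpred_sum V) => i _.
by rewrite restrict_scaleE rpredZ // sUW // mem_nth ?size_tuple.
Qed.

Definition scattered (h : nat) (U : {vspace VF}) : Prop :=
  extend_span U = fullv /\
  forall H : {vspace V}, \dim H = h -> (\dim (U :&: restrict_vs H) <= h)%N.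

End RestrictScalars.

Section FiniteGeometry.
Variables (F : finFieldType) (L : fieldExtType F) (V : vectType L).
Local Notation VF := (restrict_scalars V).

HB.instance Definition _ := Finite.copy VF (finvect_type VF).

Let vs_mx (W : {vspace V}) : 'M[finvect_type L]_(dim V) :=
  VectorInternalTheory.vs2mx W.
Let mx_vs (A : 'M[finvect_type L]_(dim V)) : {vspace V} :=
  VectorInternalTheory.mx2vs (A : 'M[L]_(dim V)).

Fact vs_mxK : cancel vs_mx mx_vs.
Proof. exact: VectorInternalTheory.vs2mxK. Qed.

HB.instance Definition _ := isCountable.Build {vspace V}
  (pcan_pickleK (can_pcan vs_mxK)).
HB.instance Definition _ := isFinite.Build {vspace V}
  (pcan_enumP (can_pcan vs_mxK)).

(* Points of PG(V, L) are the 1-dimensional L-subspaces of V. *)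
Definition linear_set (U : {vspace VF}) : {set {vspace V}} :=
  [set <[(u : V)]>%VS | u : VF in U & u != 0].

Definition hyperplanes : {set {vspace V}} :=
  [set H : {vspace V} | (\dim H).+1 == \dim {:V}].

Definition linear_set_in (U : {vspace VF}) (H : {vspace V}) :
    {set {vspace V}} :=
  [set P in linear_set U | (P <= H)%VS].

End FiniteGeometry.

Definition theta (q : nat) (m : int) : rat :=
  (q%:R ^ (m + 1) - 1) / (q%:R - 1).

Definition qbinom (q : nat) (s t : int) : rat :=
  if [|| s < 0, t < 0 | s < t] then 0
  else \prod_(1 <= i < `|t|.+1)
    ((q%:R ^ (s - i%:Z + 1) - 1) / (q%:R ^ i%:Z - 1)).

(* Main.v *)
Require Import Defs.
From HB Require Import structures.
From mathcomp Require Import all_boot all_order all_algebra all_field.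
From mathcomp Require Import sesquilinear ring zify.

Import Order.TTheory GRing.Theory Num.Theory.
Local Open Scope ring_scope.

(** Hyperplanes are described by vectors through a dual pairing, and the
    statement becomes an exact count of the solutions of linear conditions.

    Fix a nonzero F-linear functional tau on L and the coordinate dot product
    (v, w) on V. Each hyperplane is the orthogonal v^perp of q^n - 1 nonzero
    vectors v. To v attach the F-subspace A_v of L (annL U v) made of the a
    such that tau (a (v, u)) = 0 for all u in U. It is the orthogonal, for the
    form tau (a b), of the image of U under (v, -), whose kernel on U is the
    intersection of U with v^perp, so that
      dim A_v + k = n + dim (U meet v^perp)             (dim_annL).

    Scatteredness enters through one fact. If a_1, ..., a_m are F-independent
    in L and m <= h + 1, then sum_j a_j w_j = 0 with w_j in U forces all w_j
    to be 0: expand the w_j on a basis of their F-span; that basis has at most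
    h + 1 elements, hence is L-free because U is h-scattered, and then the
    coefficients vanish because the a_j are independent (scattered_tensor).
    So the sum of the a_j U is direct, of F-dimension m k (dim_spanL). Now v is
    orthogonal to this sum for tau (v, w) exactly when all a_j lie in A_v.
    Hence exactly q^(r n - m k) vectors v have a given free m-tuple in A_v.
    For m = h + 1 this number is 1 because (h + 1) k = r n, so that
    dim A_v <= h for v <> 0 (dim_annL_leq): this is the first claim.

    For the second, counting the pairs (v, free s-tuple of A_v) in two ways
    gives for each s <= h + 1 the q-binomial moment of the dimensions
      sum_(v <> 0) [dim A_v, s] = [n, s] (q^(k (h + 1 - s)) - 1)
    (qffact_moment). q-binomial inversion (qbin_moment_inversion) extracts the
    number of v with dim A_v = i, and dividing by q^n - 1 counts hyperplanes.

    Finally, h-scattered with h >= 1 implies that a point of the linear set is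
    spanned by exactly q - 1 vectors of U, so that |H meet L_U| determines, and
    is determined by, dim (U meet H) (card_linear_set_in). *)

Set Implicit Arguments.
Unset Strict Implicit.
Unset Printing Implicit Defensive.

(** * Gaussian binomial coefficients and inversion of moments *)

Section QBinomial.
Variables (K : fieldType) (q : K).

(** When q is the order of a finite field, this is the number of free s-tuples
    in a space of dimension m. *)
Definition qffact m s : K := \prod_(t < s) (q ^+ m - q ^+ t).

Definition qbin m s : K := qffact m s / qffact s s.

Lemma qffact0 m : qffact m 0 = 1.
Proof. by rewrite /qffact big_ord0. Qed.

Lemma qffactS m s : qffact m s.+1 = qffact m s * (q ^+ m - q ^+ s).
Proof. by rewrite /qffact big_ord_recr. Qed.

Lemma qffact_small m s : (m < s)%N -> qffact m s = 0.
Proof. by move=> ms; rewrite /qffact (bigD1 (Ordinal ms)) //= subrr mul0r. Qed.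

Lemma qffactSS m s : qffact m.+1 s.+1 = (q ^+ m.+1 - 1) * q ^+ s * qffact m s.
Proof.
rewrite /qffact big_ord_recl expr0 -mulrA; congr (_ * _).
have -> : q ^+ s = \prod_(t < s) q by rewrite prodr_const card_ord.
rewrite -big_split /=.
by apply: eq_bigr => t _; rewrite !exprS -mulrBr.
Qed.

Lemma qffact_split m i s : (i <= m)%N ->
  qffact m (i + s) = qffact m i * q ^+ (i * s) * qffact (m - i) s.
Proof.
move=> im; rewrite /qffact big_split_ord /= -mulrA; congr (_ * _).
have -> : q ^+ (i * s) = \prod_(t < s) q ^+ i.
  by rewrite prodr_const card_ord exprM.
rewrite -big_split /=.
by apply: eq_bigr => t _; rewrite mulrBr -!exprD subnKC.
Qed.

Hypothesis q_neq0 : q != 0.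
Hypothesis q_nroot : forall i, (0 < i)%N -> q ^+ i != 1.

Lemma qffact_neq0 s : qffact s s != 0.
Proof.
elim: s => [|s IH]; first by rewrite qffact0 oner_neq0.
by rewrite qffactSS !mulf_neq0 ?expf_neq0 // subr_eq0 q_nroot.
Qed.

Lemma qbin0 m : qbin m 0 = 1.
Proof. by rewrite /qbin !qffact0 divr1. Qed.

Lemma qbin_small m s : (m < s)%N -> qbin m s = 0.
Proof. by move=> ms; rewrite /qbin qffact_small ?mul0r. Qed.

Lemma qbinSS m s : qbin m.+1 s.+1 = q ^+ s.+1 * qbin m s.+1 + qbin m s.
Proof.
rewrite /qbin; have := qffact_neq0 s.+1; have := qffact_neq0 s.
rewrite !(qffactSS, qffactS m) => nz.
rewrite !mulf_eq0 !negb_or => /andP[/andP[nz1 nz2] _].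
move: nz1 nz2; rewrite !exprS => nz1 nz2.
by field; rewrite nz nz2 nz1.
Qed.

Lemma qbin_trinomial n i j : (i <= n)%N ->
  qbin (i + j) i * qbin n (i + j) = qbin n i * qbin (n - i) j.
Proof.
move=> le_in; rewrite /qbin !qffact_split ?leq_addr // addKn.
have nzij : qffact (i + j) i != 0.
  have := qffact_neq0 (i + j); rewrite qffact_split ?leq_addr //.
  by rewrite !mulf_eq0 !negb_or -andbA => /andP[].
by field; rewrite !qffact_neq0 nzij expf_neq0.
Qed.

(** Pascal's rule splits each term in two, and consecutive halves cancel since
    'C(j + 1, 2) = 'C(j, 2) + j. *)
Lemma alternating_qbin_sum m N : (m <= N)%N ->
  \sum_(j < N.+1) (-1) ^+ j * q ^+ 'C(j, 2) * qbin m j = (m == 0%N)%:R.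
Proof.
case: m => [|m] mN.
  rewrite big_ord_recl big1 ?addr0 ?qbin0 ?mulr1 // => j _.
  by rewrite qbin_small ?mulr0.
case: N mN => // N mN.
rewrite big_ord_recl bin_small // !expr0 qbin0 !mul1r /=.
under eq_bigr => j _ do rewrite /bump /= add1n qbinSS mulrDr.
rewrite big_split /= [X in _ + (_ + X)]big_ord_recl /= qbin0.
rewrite [X in _ + (X + _)]big_ord_recr /= qbin_small ?ltnS // !mulr0 addr0.
rewrite bin_small // expr1 expr0 !mulr1 addrCA addNKr.
rewrite -big_split big1 //= => j _.
rewrite /bump /= add1n [in X in _ + X]binS bin1 exprD !exprS; ring.
Qed.

(** The matrices ([i, j]) and ((-1)^(i - j) q^binom(i - j, 2) [i, j]) are
    inverse to each other: the trinomial identity pulls [d, i] out of the sum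
    and leaves the alternating sum of a single row of q-binomials. *)
Lemma qbin_orthogonality d i h : (d <= h)%N -> (i <= h)%N ->
  \sum_(j < (h - i).+1)
     (-1) ^+ j * q ^+ 'C(j, 2) * (qbin (i + j) i * qbin d (i + j)) =
  (d == i)%:R.
Proof.
move=> dh ih; have [di|id] := ltnP d i.
  rewrite (ltn_eqF di) big1 // => j _.
  by rewrite [qbin d _]qbin_small ?mulr0 // ltn_addr.
under eq_bigr => j _ do rewrite qbin_trinomial // mulrCA.
rewrite -mulr_sumr alternating_qbin_sum ?leq_sub2r // subn_eq0.
have [->|ne] := eqVneq d i.
  by rewrite leqnn mulr1 /qbin divff ?qffact_neq0.
by rewrite leqNgt ltn_neqAle eq_sym ne id mulr0.
Qed.

(** The q-binomial moments of order at most h determine the distribution of a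
    statistic d bounded by h: after exchanging the sums, orthogonality applies
    to each x separately. *)
Lemma qbin_moment_inversion (T : finType) (P : pred T) (d : T -> nat) h i :
  (forall x, P x -> (d x <= h)%N) -> (i <= h)%N ->
  #|[set x | P x & d x == i]|%:R =
  \sum_(j < (h - i).+1) (-1) ^+ j * q ^+ 'C(j, 2) *
     (qbin (i + j) i * \sum_(x | P x) qbin (d x) (i + j)).
Proof.
move=> dh ih; under eq_bigr => j _ do rewrite !mulr_sumr.
rewrite exchange_big /=.
under eq_bigr => x Px do rewrite qbin_orthogonality ?dh //.
rewrite -sum1_card natr_sum big_mkcond [RHS]big_mkcond /=.
by apply: eq_bigr => x _; rewrite inE; case: (P x); case: (d x == i).
Qed.

Lemma qbin_prod m s : (s <= m)%N -> qbin m s =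
  \prod_(1 <= i < s.+1) ((q ^+ (m - i).+1 - 1) / (q ^+ i - 1)).
Proof.
elim: s m => [|s IH] m sm; first by rewrite big_geq ?qbin0.
rewrite big_nat_recr //= -IH ?(ltnW sm) // /qbin qffactSS qffactS subnSK //.
have -> : q ^+ m = q ^+ s * q ^+ (m - s) by rewrite -exprD subnKC // ltnW.
have nz1 : q ^+ s.+1 - 1 != 0 by rewrite subr_eq0 q_nroot.
by field; rewrite nz1 expf_neq0 ?qffact_neq0.
Qed.

End QBinomial.

(** * Dual pairings over L and over F *)

Section DimOrthogonal.
Variables (K : fieldType) (W : vectType K).

Lemma leq_dim_bigcap_lker m (f : 'I_m -> 'Hom(W, K^o)) :
  (\dim {:W} <= \dim (\bigcap_i lker (f i)) + m)%N.
Proof.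
elim: m f => [|m IH] f; first by rewrite big_ord0 addn0.
rewrite big_ord_recr /=; set A := (\bigcap_i _)%VS.
have := IH (fun i => f (widen_ord (leqnSn m) i)); rewrite -/A.
have := limg_ker_dim (f ord_max) A.
have : (\dim (f ord_max @: A)%VS <= 1)%N.
  by rewrite (leq_trans (dimvS (subvf _))) // dimvf.
lia.
Qed.

Variables (eps : bool) (theta : {rmorphism K -> K}).
Variable form : {hermitian W for eps & theta}.

(** Orthogonality to S is \dim S linear conditions, so one inequality always
    holds. Adding it up for S and a complement of S, whose orthogonals meet in
    the radical 0, leaves no room for strictness. *)
Lemma dim_orthov (S : {vspace W}) : nondegenerate form ->
  (\dim (orthov form S) + \dim S)%N = \dim {:W}.
Proof.
move=> /eqP rad0.
have orthov_ge T : (\dim {:W} <= \dim (orthov form T) + \dim T)%N.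
  exact: leq_dim_bigcap_lker.
apply/eqP; rewrite eqn_leq orthov_ge andbT.
have disj : (orthov form S :&: orthov form S^C = 0)%VS.
  apply/eqP; rewrite -subv0 -rad0 -(addv_complf S) orthovD.
  by rewrite capvSl capvSr.
have := dimv_sum_cap (orthov form S) (orthov form S^C).
rewrite disj dimv0 addn0 => dE.
have := dimvS (subvf (orthov form S + orthov form S^C)).
have := orthov_ge S^C%VS; rewrite dimv_compl.
have := dimvS (subvf S); lia.
Qed.

End DimOrthogonal.

Section Forms.
Variables (F : fieldType) (L : fieldExtType F) (V : vectType L).
Local Notation VF := (restrict_scalars V).

(** Any nonzero F-linear functional on L would do, e.g. the trace when L is
    separable; this one is chosen because it visibly sends 1 to 1. *)
Definition functional (a : L) : F := coord [tuple 1 : L] ord0 a.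

Lemma functional_linear : scalar functional.
Proof. exact: linearP. Qed.

HB.instance Definition _ :=
  GRing.isLinear.Build F L F _ functional functional_linear.

Lemma functional_nondegenerate a :
  (forall b, functional (b * a) = 0) -> a = 0.
Proof.
move=> a0; apply/eqP; apply: contraT => nza.
have := a0 a^-1; rewrite mulVf // /functional.
rewrite (@coord_free _ _ _ [tuple 1 : L] ord0) ?eqxx; last first.
  by rewrite seq1_free oner_neq0.
by move/eqP; rewrite oner_eq0.
Qed.

Definition mulform (a b : L) : F := functional (a * b).

Fact mulform_bilinear : bilinear_for *%R *%R mulform.
Proof.
split=> c a u v; first by rewrite /mulform mulrDl -scalerAl linearP.
by rewrite /mulform mulrDr -scalerAr linearP.
Qed.
HB.instance Definition _ :=
  bilinear_isBilinear.Build F L L F *%R (idfun \; *%R) mulform mulform_bilinear.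
Fact mulform_sym a b : mulform a b = (-1) ^+ false * idfun (mulform b a).
Proof. by rewrite mul1r /mulform mulrC. Qed.
HB.instance Definition _ :=
  isHermitianSesquilinear.Build F L false idfun mulform mulform_sym.

Definition dotv (v w : V) : L :=
  \sum_i coord (vbasis {:V}) i v * coord (vbasis {:V}) i w.

Fact dotv_bilinear : bilinear_for *%R *%R dotv.
Proof.
split=> c a u v; rewrite /dotv /= mulr_sumr -big_split /=;
  apply: eq_bigr => i _.
  by rewrite linearP /= mulrDl mulrA.
by rewrite linearP /= mulrDr mulrCA.
Qed.
HB.instance Definition _ :=
  bilinear_isBilinear.Build L V V L *%R (idfun \; *%R) dotv dotv_bilinear.
Fact dotv_sym v w : dotv v w = (-1) ^+ false * idfun (dotv w v).
Proof. by rewrite mul1r /dotv; apply: eq_bigr => i _; rewrite mulrC. Qed.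
HB.instance Definition _ :=
  isHermitianSesquilinear.Build L V false idfun dotv dotv_sym.

Lemma dotv_eq0 v : (forall w, dotv v w = 0) -> v = 0.
Proof.
move=> v0; rewrite (coord_vbasis (memvf v)) big1 // => i _.
have := v0 (vbasis {:V})`_i; rewrite /dotv (bigD1 i) //=.
rewrite coord_free ?(basis_free (vbasisP _)) // eqxx mulr1 big1 ?addr0.
  by move=> ->; rewrite scale0r.
move=> j /negPf ji; rewrite coord_free ?(basis_free (vbasisP _)) //.
by rewrite eq_sym ji mulr0.
Qed.

Definition fdotv (v w : VF) : F := functional (dotv v w).

Lemma fdotvZr (a : L) (v w : V) :
  fdotv v (a *: w : V) = mulform a (dotv v w).
Proof. by rewrite /fdotv linearZr. Qed.

Fact fdotv_bilinear : bilinear_for *%R *%R fdotv.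
Proof.
split=> c a u v.
  rewrite /fdotv -linearP; congr functional; rewrite restrict_scaleE.
  by rewrite linearPl /= -scalerAl mul1r.
rewrite /fdotv -linearP; congr functional; rewrite restrict_scaleE.
by rewrite linearPr /= -scalerAl mul1r.
Qed.
HB.instance Definition _ :=
  bilinear_isBilinear.Build F VF VF F *%R (idfun \; *%R) fdotv fdotv_bilinear.
Fact fdotv_sym v w : fdotv v w = (-1) ^+ false * idfun (fdotv w v).
Proof. by rewrite mul1r /fdotv dotv_sym mul1r. Qed.
HB.instance Definition _ :=
  isHermitianSesquilinear.Build F VF false idfun fdotv fdotv_sym.

Lemma mulform_nondegenerate : nondegenerate mulform.
Proof.
rewrite /nondegenerate -subv0; apply/subvP=> a /mem_orthovP a0.
rewrite memv0; apply/eqP/functional_nondegenerate => b.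
by rewrite mulrC; apply: a0; apply: memvf.
Qed.

Lemma dotv_nondegenerate : nondegenerate dotv.
Proof.
rewrite /nondegenerate -subv0; apply/subvP=> v /mem_orthovP v0.
by rewrite memv0; apply/eqP/dotv_eq0 => w; apply: v0; apply: memvf.
Qed.

Lemma fdotv_nondegenerate : nondegenerate fdotv.
Proof.
rewrite /nondegenerate -subv0; apply/subvP=> v /mem_orthovP v0.
rewrite memv0; apply/eqP/dotv_eq0 => w; apply: functional_nondegenerate => b.
rewrite -[functional _]/(mulform b (dotv v w)) -fdotvZr.
by apply: v0; apply: memvf.
Qed.

End Forms.

(** * Scattered subspaces *)

Lemma ltn_dim_addv_line (K : fieldType) (W : vectType K) (A : {vspace W}) u :
  u \notin A -> (\dim A < \dim (A + <[u]>)%VS)%N.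
Proof.
move=> uA; rewrite ltn_neqAle dimvS ?addvSl // andbT.
apply: contra uA => /eqP dE.
have /eqP -> : A == (A + <[u]>)%VS by rewrite eqEdim addvSl dE /=.
by rewrite memvE addvSr.
Qed.

Section Scattered.
Variables (F : fieldType) (L : fieldExtType F) (V : vectType L).
Local Notation VF := (restrict_scalars V).

Definition scalev (a : L) (v : VF) : VF := (a *: (v : V) : V).

Fact scalev_linear a : linear (scalev a).
Proof.
move=> c u v; rewrite restrict_scaleE /scalev.
by rewrite (@scalerDr L V) restrict_scaleE !scalerA mulrC.
Qed.
HB.instance Definition _ a :=
  GRing.isLinear.Build F VF VF _ (scalev a) (scalev_linear a).

(** The image of A (x) U in V, for A the F-span of a. *)
Definition spanL (m : nat) (a : m.-tuple L) (U : {vspace VF}) : {vspace VF} :=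
  (\sum_(j < m) (linfun (scalev a`_j) @: U))%VS.

Variables (U : {vspace VF}) (h : nat).
Hypothesis scU : scattered h U.
Hypothesis hV : (h < \dim {:V})%N.

(** The scattered condition is inherited by smaller dimensions: while
    \dim H < h, U has a vector outside H because it spans V; adding this vector
    to H raises \dim H by one and the dimension of the intersection by at least
    one. *)
Lemma scattered_leq (H : {vspace V}) : (\dim H <= h)%N ->
  (\dim (U :&: restrict_vs H) <= \dim H)%N.
Proof.
have [e] := ubnP (h - \dim H); elim: e H => // e IH H leHe leHh.
have [dH|neH] := eqVneq (\dim H) h; first by rewrite dH; apply: scU.2.
have ltHh : (\dim H < h)%N by rewrite ltn_neqAle neH.
have /subvPn[u uU uH] : ~~ (U <= restrict_vs H)%VS.
  apply/negP => /subvP sUH.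
  have : (extend_span U <= H)%VS.
    by apply/extend_span_subP => u /sUH; rewrite mem_restrict_vs.
  by rewrite scU.1 => /dimvS; lia.
rewrite mem_restrict_vs in uH.
pose H' := (H + <[u : V]>)%VS.
have H'gt : (\dim H < \dim H')%N by apply: ltn_dim_addv_line.
have H'le : (\dim H' <= \dim H + 1)%N.
  rewrite (leq_trans (dimv_add_leqif _ _).1) // leq_add2l dim_vline.
  by case: (_ == _).
have := IH H'; set D' := \dim (_ :&: _).
suff : (\dim (U :&: restrict_vs H) < D')%N by lia.
apply: leq_trans (_ : \dim ((U :&: restrict_vs H) + <[u]>)%VS <= _)%N.
  by apply: ltn_dim_addv_line; rewrite memv_cap uU mem_restrict_vs.
apply: dimvS; rewrite subv_add -memvE memv_cap uU mem_restrict_vs /=.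
apply/andP; split; last by rewrite memvE addvSr.
apply: capvS => //; apply/subvP => x; rewrite !mem_restrict_vs.
by apply/subvP/addvSl.
Qed.

(** Otherwise the L-span of X would have dimension at most h, and smaller than
    the number of independent vectors of U in it. *)
Lemma scattered_free (X : seq VF) : {subset X <= U} -> free X ->
  (size X <= h.+1)%N -> free (X : seq V).
Proof.
move=> XU frX szX; rewrite /free eqn_leq dim_span leqNgt /=.
apply/negP => ltX.
have := scattered_leq (leq_trans ltX szX).
have : (\dim <<X>> <= \dim (U :&: restrict_vs <<X : seq V>>))%N.
  apply/dimvS/span_subvP => x xX; rewrite memv_cap XU // mem_restrict_vs.
  exact: (@memv_span _ V).
by rewrite (eqnP frX) => le1 le2; have := leq_trans le1 le2; rewrite leqNgt ltX.
Qed.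

(** Injectivity of A (x) U -> V for A of F-dimension at most h + 1. *)
Lemma scattered_tensor m (a : m.-tuple L) (w : 'I_m -> VF) :
  free a -> (m <= h.+1)%N -> (forall j, w j \in U) ->
  \sum_(j < m) scalev a`_j (w j) = 0 -> forall j, w j = 0.
Proof.
move=> fra mh wU sum0.
(* Over a basis X of the F-span of the w_j, the relation becomes a relation
   between at most h + 1 vectors of U with coefficients in the span of a. *)
pose X := vbasis <<codom w>>.
have wX j : w j \in <<codom w>>%VS by apply/memv_span/codom_f.
have sX : {subset X <= U}.
  move=> x /vbasis_mem; apply/subvP/span_subvP => _ /codomP[j ->].
  exact: wU.
have frX : free (X : seq V).
  apply: scattered_free => //; first exact: (basis_free (vbasisP _)).
  rewrite size_tuple (leq_trans (dim_span _)) // size_codom card_ord.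
  exact: mh.
pose c i j := coord X i (w j).
have c0 i : \sum_(j < m) c i j *: a`_j = 0.
  apply: (elimT (@freeP _ V _ X) frX (fun i => \sum_(j < m) c i j *: a`_j)).
  rewrite -[RHS]sum0; under eq_bigr => k _ do rewrite scaler_suml.
  rewrite exchange_big /=; apply: eq_bigr => j _.
  rewrite [in RHS](coord_vbasis (wX j)) linear_sum /=.
  apply: eq_bigr => k _; rewrite /scalev restrict_scaleE scalerA.
  by congr (_ *: _); rewrite mulrC -scalerAl mul1r.
move=> j; rewrite (coord_vbasis (wX j)) big1 // => i _.
have := elimT (@freeP _ _ _ a) fra (c i) (c0 i) j.
by rewrite /c => ->; rewrite scale0r.
Qed.

Lemma dim_spanL m (a : m.-tuple L) : free a -> (m <= h.+1)%N ->
  \dim (spanL a U) = (m * \dim U)%N.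
Proof.
move=> fra mh; have /directvP/= -> : directv (spanL a U).
  apply/directv_sum_independent => us usU us0 j _.
  have /fin_all_exists2[w wU wE] i : exists2 u, u \in U & us i = scalev a`_i u.
    by have /memv_imgP[u uU ->] := usU i isT; exists u; rewrite ?lfunE.
  rewrite wE (scattered_tensor fra mh wU) ?linear0 //.
  by rewrite -[RHS]us0; apply: eq_bigr => i _; rewrite wE.
rewrite -[X in (X * _)%N]card_ord -sum_nat_const; apply: eq_bigr => j _.
apply: limg_dim_eq; apply/eqP; rewrite -subv0; apply/subvP=> v.
rewrite memv_cap memv_ker lfunE memv0 => /andP[_].
rewrite -[_ == _]/((a`_j *: (v : V) : V) == 0) scaler_eq0.
rewrite (negPf (free_not0 fra _)) //.
by rewrite mem_nth ?size_tuple.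
Qed.

End Scattered.

(** * The annihilator in L of a vector *)

Section Dual.
Variables (F : fieldType) (L : fieldExtType F) (V : vectType L).
Local Notation VF := (restrict_scalars V).

Implicit Types (U : {vspace VF}) (v : V) (a : L).

Fact dotv_F_linear (v : V) : linear (dotv v : VF -> L).
Proof.
by move=> c u w; rewrite restrict_scaleE linearPr /= -scalerAl mul1r.
Qed.

(** dotv v again, as an F-linear map. *)
Definition evalv (v : V) (u : VF) : L := dotv v u.
HB.instance Definition _ v :=
  GRing.isLinear.Build F VF L _ (evalv v) (dotv_F_linear v).

Definition annL (U : {vspace VF}) (v : V) : {vspace L} :=
  orthov (@mulform F L) (linfun (evalv v) @: U)%VS.

Lemma lker_evalv v : lker (linfun (evalv v)) =
  restrict_vs (orthov (@dotv F L V) <[v]>).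
Proof.
apply/vspaceP => u; rewrite memv_ker lfunE mem_restrict_vs mem_orthov1.
by rewrite [RHS]herm_eq0C.
Qed.

(** Rank-nullity for dotv v on U, then the dimension of the orthogonal of its
    image. *)
Lemma dim_annL U v :
  (\dim (annL U v) + \dim U =
   \dim {:L} + \dim (U :&: restrict_vs (orthov (@dotv F L V) <[v]>)))%N.
Proof.
rewrite -lker_evalv -(limg_ker_dim (linfun (evalv v)) U).
by rewrite addnCA addnC (dim_orthov _ (mulform_nondegenerate L)).
Qed.

Lemma mem_annL U v a :
  reflect (forall u, u \in U -> mulform a (dotv v u) = 0) (a \in annL U v).
Proof.
apply: (iffP mem_orthovP) => [a0 u uU|a0 _ /memv_imgP[u uU ->]].
  by have := a0 (linfun (evalv v) u) (memv_img _ uU); rewrite lfunE.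
by rewrite lfunE; apply: a0.
Qed.

(** The pivot of the double counting: as a condition on v it is linear, with
    a solution space of known dimension when a is free; as a condition on a it
    says that a is made of elements of a single subspace of L. *)
Lemma mem_orthov_spanL U v m (a : m.-tuple L) :
  ((v : VF) \in orthov (@fdotv F L V) (spanL a U)) =
  all [in annL U v] a.
Proof.
apply/mem_orthovP/allP => [v0 _ /(nthP 0)[j jm <-]|a0 _ /memv_sumP[w wU ->]].
  rewrite size_tuple in jm; apply/mem_annL => u uU; rewrite -fdotvZr.
  have := v0 (scalev a`_j u); apply.
  rewrite (subvP (sumv_sup (Ordinal jm) isT (subvv _))) //.
  by rewrite -[scalev _ _](lfunE (scalev a`_j)) memv_img.
rewrite linear_sumr big1 // => j _.
have /memv_imgP[u uU ->] := wU j isT.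
rewrite lfunE /= fdotvZr; apply/(mem_annL U v) => //.
by apply: a0; rewrite mem_nth ?size_tuple.
Qed.

(** A free (h + 1)-tuple in annL U v would put v in the orthogonal of a subspace
    of dimension (h + 1) \dim U, that is, of the whole space. *)
Lemma dim_annL_leq U h v : scattered h U -> (h < \dim {:V})%N ->
  (h.+1 * \dim U = \dim {:VF})%N -> v != 0 -> (\dim (annL U v) <= h)%N.
Proof.
move=> scU hV dimU; apply: contraNT; rewrite -ltnNge => hA.
have szA : size (take h.+1 (vbasis (annL U v))) == h.+1.
  by rewrite size_takel ?size_tuple.
pose a := Tuple szA.
have fra : free a.
  have := basis_free (vbasisP (annL U v)).
  by rewrite -[X in free X -> _](cat_take_drop h.+1) => /catl_free.
have /eqP := dim_orthov (spanL a U) (fdotv_nondegenerate V).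
rewrite (dim_spanL scU) // dimU -[X in _ == X]add0n eqn_add2r dimv_eq0.
move=> /eqP o0; suff : (v : VF) \in 0%VS by rewrite memv0.
rewrite -o0 mem_orthov_spanL; apply/allP => x /mem_take.
exact: vbasis_mem.
Qed.

End Dual.

(** * Counting free tuples and moments of the annihilators *)

Section FreeTuples.
Variables (F : finFieldType) (T : finType) (cvT : Vector F T).
Let vT := Vector.Pack cvT.
Variable R : fieldType.

Lemma card_nonzero_vspace (A : {vspace vT}) :
  #|[set v : T | (v : vT) \in A] :\ (0 : vT)|%:R =
  (#|F|%:R ^+ \dim A - 1 :> R).
Proof.
rewrite -natrX -card_vspace -[in RHS]cardsE [in RHS](cardsD1 (0 : vT)).
have -> : (0 : vT) \in [set v : T | (v : vT) \in A].
  by rewrite inE; apply: mem0v.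
by rewrite natrD addrC addKr.
Qed.

(** A free s-tuple of A is extended by any vector of A outside its span, which
    has q^s elements. *)
Lemma card_free_tuples (A : {vspace vT}) s :
  #|[set a : s.-tuple T | free (a : seq vT) & all [in A] (a : seq vT)]|%:R =
  qffact (#|F|%:R : R) (\dim A) s.
Proof.
elim: s => [|s IH].
  rewrite qffact0 (_ : [set _ | _] = setT) ?cardsT ?card_tuple //.
  by apply/setP => a; rewrite !inE tuple0 /= nil_free.
rewrite qffactS -IH -[in LHS]sum1_card -[X in X%:R * _]sum1_card !natr_sum.
rewrite mulr_suml.
rewrite (reindex (fun p : s.-tuple T * T => cons_tuple p.2 p.1)) /=; last first.
  exists (fun a : s.+1.-tuple T => (behead_tuple a, thead a)) => [[t x] _|a _].
    by congr (_, _); apply: val_inj.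
  by rewrite [RHS]tuple_eta; apply: val_inj.
under eq_bigl => p do rewrite inE /= free_cons.
transitivity (\sum_(t : s.-tuple T |
      free (t : seq vT) && all [in A] (t : seq vT))
    \sum_(x : T | ((x : vT) \in A) && ((x : vT) \notin <<(t : seq vT)>>%VS))
      (1 : R)).
  rewrite pair_big_dep /=; apply: eq_bigl => p /=.
  by do 4! case: (_ \in _) || case: (free _) || case: (all _ _).
rewrite [RHS](eq_bigl (fun t : s.-tuple T =>
  free (t : seq vT) && all [in A] (t : seq vT))); last by move=> t; rewrite inE.
apply: eq_bigr => t /andP[frt tA].
rewrite mul1r sumr_const.
have tsub : (<<(t : seq vT)>> <= A)%VS.
  by apply/span_subvP => x xt; apply: (allP tA).
have ct : #|(<<(t : seq vT)>>%VS : {vspace vT})| = (#|F| ^ s)%N.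
  by rewrite card_vspace (eqnP frt) size_tuple.
rewrite -!natrX -ct -card_vspace.
rewrite -[X in X%:R - _](cardID [in (<<(t : seq vT)>>%VS : {vspace vT})]) natrD.
rewrite (_ : #|[predI _ & _]| = #|(<<(t : seq vT)>>%VS : {vspace vT})|).
  rewrite addrAC subrr add0r; congr _%:R; apply: eq_card => x.
  by rewrite !inE andbC.
by apply: eq_card => x; rewrite !inE andb_idl // => /(subvP tsub).
Qed.

End FreeTuples.

Section Moments.
Variables (F : finFieldType) (L : fieldExtType F) (V : vectType L).
Local Notation VF := (restrict_scalars V).
Variables (U : {vspace VF}) (h : nat).
Hypothesis scU : scattered h U.
Hypothesis hV : (h < \dim {:V})%N.
Variable R : fieldType.
Let q : R := #|F|%:R.

(** Both sides count the pairs of a nonzero v and a free s-tuple of annL U v; on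
    the right the tuple is chosen first. *)
Lemma qffact_moment s : (s <= h.+1)%N ->
  \sum_(v : VF | v != 0) qffact q (\dim (annL U v)) s =
  qffact q (\dim {:L}) s * (q ^+ (\dim {:VF} - s * \dim U) - 1).
Proof.
move=> sh.
pose fits (v : VF) (a : s.-tuple (finvect_type L)) :=
  all [in annL U v] (a : seq L).
transitivity (\sum_(v : VF | v != 0)
    \sum_(a : s.-tuple (finvect_type L) | free (a : seq L) && fits v a)
       (1 : R)).
  apply: eq_bigr => v _; rewrite sumr_const -cardsE.
  exact/esym/card_free_tuples.
rewrite (exchange_big_dep (fun a : s.-tuple (finvect_type L) =>
  free (a : seq L))) /=; last first.
  by move=> v a _ /andP[].
transitivity (\sum_(a : s.-tuple (finvect_type L) | free (a : seq L))
    (q ^+ (\dim {:VF} - s * \dim U) - 1)); last first.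
  rewrite sumr_const -mulr_natl; congr (_ * _).
  rewrite -cardsE; apply: etrans; last first.
    exact: (card_free_tuples (F:=F) (T:=finvect_type L) R {:L}%VS s).
  congr _%:R; apply: eq_card => a.
  by rewrite !inE (introT allP) ?andbT // => x _; apply: memvf.
apply: eq_bigr => a fra; rewrite sumr_const.
have dO := dim_orthov (spanL (a : s.-tuple L) U) (fdotv_nondegenerate V).
rewrite (dim_spanL scU) // in dO.
rewrite -dO addnK -card_nonzero_vspace; congr _%:R.
apply: eq_card => v; rewrite !inE mem_orthov_spanL.
by rewrite fra.
Qed.

End Moments.

(** * Points and hyperplanes *)

Section Geometry.
Variables (F : finFieldType) (L : fieldExtType F) (V : vectType L).
Local Notation VF := (restrict_scalars V).

(** The nonzero vectors of U in H are distributed over the points of the linear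
    set in H. As h > 0, U meets a point, which is a 1-dimensional L-space, in
    F-dimension at most 1, so that q - 1 of them fall on each point. *)
Lemma card_linear_set_in (R : fieldType) (U : {vspace VF}) (h : nat)
    (H : {vspace V}) :
  scattered h U -> (0 < h)%N -> (h < \dim {:V})%N ->
  #|linear_set_in U H|%:R * (#|F|%:R - 1 : R) =
  #|F|%:R ^+ \dim (U :&: restrict_vs H) - 1.
Proof.
move=> scU h0 hV; pose W := (U :&: restrict_vs H)%VS.
pose D := [set u : VF | u \in W] :\ 0.
have -> : linear_set_in U H = [set <[u : V]>%VS | u : VF in D].
  apply/setP=> P; rewrite inE; apply/andP/imsetP.
    case=> /imsetP[u]; rewrite inE => /andP[uU u0] -> uH.
    by exists u; rewrite // !inE u0 memv_cap uU mem_restrict_vs.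
  case=> u; rewrite !inE memv_cap mem_restrict_vs => /and3P[u0 uU uH] ->.
  by split; first by apply/imsetP; exists u; rewrite // inE uU.
rewrite -card_nonzero_vspace -[in RHS]sum1_card.
rewrite (partition_big_imset (fun u : VF => <[u : V]>%VS)) /= natr_sum.
rewrite -[in LHS]sum1_card natr_sum mulr_suml; apply: eq_bigr => P.
case/imsetP=> u; rewrite !inE memv_cap mem_restrict_vs => /and3P[u0 uU uH] ->.
rewrite mul1r sum1_card.
have dP : \dim (U :&: restrict_vs <[u : V]>)%VS = 1%N.
  have u0V : (u : V) != 0 by [].
  have := scattered_leq scU hV (H := <[u : V]>%VS).
  rewrite dim_vline u0V => /(_ h0) dle; apply/eqP; rewrite eqn_leq dle.
  rewrite lt0n dimv_eq0; apply: contra u0 => /eqP W0.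
  by rewrite -memv0 -W0 memv_cap uU mem_restrict_vs memv_line.
have := card_nonzero_vspace R (U :&: restrict_vs <[u : V]>)%VS.
rewrite dP expr1 => <-; congr _%:R; apply: eq_card => w.
rewrite [RHS]unfold_in /= !inE !memv_cap !mem_restrict_vs.
apply/and3P/andP => [[w0 wU wu]|[/and3P[w0 wU wH] /eqP <-]]; last first.
  by rewrite memv_line.
have -> : (w : V) \in H by rewrite (subvP _ _ wu) // -memvE.
by split; [rewrite w0 wU | rewrite eqEdim -memvE wu !dim_vline w0 u0].
Qed.

Lemma card_line_nonzero (R : fieldType) (w : V) : w != 0 ->
  #|[set v : VF | v != 0 & (v : V) \in <[w]>%VS]|%:R =
  (#|F|%:R ^+ \dim {:L} - 1 : R).
Proof.
move=> w0.
have := @card_nonzero_vspace F (finvect_type L) _ R {:L}%VS.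
move=> <-; congr _%:R; symmetry.
rewrite -(card_imset _ (f := fun a : finvect_type L => (a : L) *: w : VF)).
  apply: eq_card => v; rewrite [RHS]inE; apply/imsetP/andP.
- case=> a; rewrite !inE => /andP[a0 _] ->.
  split; last by apply: memvZ; apply: memv_line.
  apply: contra a0 => aw0; have : (a : L) *: w == 0 by exact: aw0.
  by rewrite scaler_eq0 (negPf w0) orbF.
- case=> v0 /vlineP[a vE]; exists a; last exact: vE.
  rewrite !inE memvf andbT; apply: contra v0 => /eqP a0.
  by rewrite vE a0 scale0r.
move=> a b ab; have : ((a : L) - (b : L)) *: w == 0.
  by rewrite scalerBl subr_eq0; apply/eqP.
by rewrite scaler_eq0 (negPf w0) orbF subr_eq0 => /eqP.
Qed.

Definition vperp (v : V) : {vspace V} := orthov (@dotv F L V) <[v]>.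

Lemma vperp_hyperplane v : v != 0 -> vperp v \in hyperplanes V.
Proof.
move=> v0; rewrite inE -(dim_orthov <[v]> (dotv_nondegenerate V)).
by rewrite dim_vline v0 addn1.
Qed.

Lemma hyperplane_orthov (H : {vspace V}) : H \in hyperplanes V ->
  exists2 w, w != 0 & orthov (@dotv F L V) H = <[w]>%VS.
Proof.
rewrite inE -(dim_orthov H (dotv_nondegenerate V)) -add1n eqn_add2r => /eqP d1.
pose w := vpick (orthov (@dotv F L V) H).
have w0 : w != 0 by rewrite vpick0 -dimv_eq0 -d1.
exists w => //; apply/eqP; rewrite eq_sym eqEdim -memvE memv_pick.
by rewrite -d1 dim_vline w0.
Qed.

Lemma vperp_eq (H : {vspace V}) v : H \in hyperplanes V -> v != 0 ->
  (vperp v == H) = (v \in orthov (@dotv F L V) H).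
Proof.
move=> Hhyp v0; rewrite mem_orthov_sym eq_sym eqEdim andbC.
have := vperp_hyperplane v0; move: Hhyp; rewrite !inE => /eqP <-.
by rewrite eqSS => /eqP ->; rewrite leqnn.
Qed.

(** Every hyperplane H is vperp v for the q^n - 1 nonzero v of the line
    orthogonal to H. *)
Lemma card_vperp (R : fieldType) (P : pred {vspace V}) :
  #|[set v : VF | v != 0 & P (vperp v)]|%:R =
  (#|F|%:R ^+ \dim {:L} - 1 : R) * #|[set H in hyperplanes V | P H]|%:R.
Proof.
rewrite -sum1_card (partition_big (fun v : VF => vperp v)
  [in [set H in hyperplanes V | P H]]) /=; last first.
  move=> v; rewrite !inE => /andP[v0 ->].
  by have := vperp_hyperplane v0; rewrite inE => ->.
rewrite natr_sum -[X in _ * X%:R]sum1_card natr_sum mulr_sumr.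
apply: eq_bigr => H; rewrite inE => /andP[Hhyp PH].
have [w w0 Hw] := hyperplane_orthov Hhyp.
rewrite mulr1 -(card_line_nonzero _ w0) sum1_card; congr _%:R.
apply: eq_card => v; rewrite [LHS]unfold_in /= !inE.
case v0: (v == 0) => //=.
have [vH|nvH] := eqVneq (vperp v) H.
  by rewrite vH PH -Hw -vperp_eq ?v0 // vH eqxx.
by rewrite andbF -Hw -vperp_eq ?v0 // (negPf nvH).
Qed.

End Geometry.

(** * The intersection numbers *)

Section RationalQ.
Variable q : nat.
Hypothesis q_gt1 : (1 < q)%N.

Lemma natq_gt1 : (1 < q%:R :> rat).
Proof. by rewrite ltr1n. Qed.

Lemma natq_neq0 : (q%:R : rat) != 0.
Proof. by rewrite pnatr_eq0 -lt0n ltnW. Qed.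

Lemma natq_nroot i : (0 < i)%N -> (q%:R : rat) ^+ i != 1.
Proof. by move=> i0; rewrite gt_eqF // exprn_egt1 ?natq_gt1 // -lt0n. Qed.

Lemma theta_inj : injective (theta q).
Proof.
have q1 := natq_gt1; have nz : (q%:R : rat) - 1 != 0 by rewrite subr_eq0 gt_eqF.
move=> a b /(mulIf (invr_neq0 nz)) /addIr.
by move/(ieexprIz (lt_trans ltr01 q1) (negbT (gt_eqF q1)))/addIr.
Qed.

Lemma qbinomE (m s : nat) : qbinom q m%:Z s%:Z = qbin (q%:R : rat) m s.
Proof.
rewrite /qbinom /= ltz_nat; case: ltnP => [ms|sm].
  by rewrite qbin_small.
rewrite (qbin_prod natq_neq0 natq_nroot sm).
apply: eq_big_nat => i /andP[i1 is1].
congr ((_ - 1) / _); rewrite exprnP; congr (_ ^ _); lia.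
Qed.

End RationalQ.

Theorem corollary7p2 (q r n h : nat) (F : finFieldType) (L : fieldExtType F)
    (V : vectType L) (U : {vspace restrict_scalars V})
    (k := (r * n %/ h.+1)%N) :
  #|F| = q -> \dim {:L} = n -> \dim {:V} = r ->
  (0 < r)%N -> (0 < n)%N -> (0 < h)%N -> (h <= r - 1)%N ->
  (h.+1 %| r * n)%N ->
  \dim U = k ->
  scattered h U ->
  (forall H : {vspace V}, H \in hyperplanes V ->
     exists2 i : nat, (i <= h)%N &
       #|linear_set_in U H|%:R = theta q (k%:Z - n%:Z + i%:Z - 1)) /\
  (forall i : nat, (i <= h)%N ->
     #|[set H in hyperplanes V |
         #|linear_set_in U H|%:R == theta q (k%:Z - n%:Z + i%:Z - 1)]|%:R =
     (q%:R ^+ n - 1)^-1 * qbinom q n%:Z i%:Z *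
     \sum_(0 <= j < (h - i).+1)
        (-1) ^+ j * qbinom q (n%:Z - i%:Z) j%:Z * q%:R ^+ 'C(j, 2) *
        (q%:R ^+ (r * n * (h - i - j + 1) %/ h.+1) - 1) :> rat).
Proof.
move=> cF dL dV r0 n0 h0 hr hdvd dU scU.
have q1 : (1 < q)%N by rewrite -cF finNzRing_gt1.
have hV : (h < \dim {:V})%N by lia.
have rn : (r * n = h.+1 * k)%N by rewrite [RHS]mulnC divnK.
have dVF : \dim {:restrict_scalars V} = (r * n)%N by rewrite dimvf -dL -dV.
have dh (v : restrict_scalars V) : v != 0 -> (\dim (annL U v) <= h)%N.
  by apply: dim_annL_leq => //; rewrite dU dVF rn.
have dcap v : (\dim (U :&: restrict_vs (vperp v)) + n = k + \dim (annL U v))%N.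
  by rewrite addnC -dL -dim_annL dU addnC.
have qR1 : (q%:R : rat) - 1 != 0 by rewrite subr_eq0 pnatr_eq1; lia.
have cardE H : #|linear_set_in U H|%:R =
    theta q ((\dim (U :&: restrict_vs H))%:Z - 1).
  rewrite /theta subrK -exprnP -cF -(card_linear_set_in _ H scU) // cF mulfK //.
have thetaE H (i : nat) :
    (#|linear_set_in U H|%:R == theta q (k%:Z - n%:Z + i%:Z - 1)) =
    (\dim (U :&: restrict_vs H) + n == k + i)%N.
  by rewrite cardE (inj_eq (theta_inj q1)); apply/eqP/eqP; lia.
split=> [H Hhyp|i ih].
  have [w w0 Hw] := hyperplane_orthov Hhyp.
  have HE : vperp w = H by apply/eqP; rewrite vperp_eq // Hw memv_line.
  exists (\dim (annL U w)); first exact: dh.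
  by apply/eqP; rewrite thetaE -HE dcap.
have qn1 : (q%:R : rat) ^+ n - 1 != 0 by rewrite subr_eq0 natq_nroot.
apply: (mulfI qn1); rewrite !mulrA divff // mul1r.
have := card_vperp rat (fun H : {vspace V} =>
  #|linear_set_in U H|%:R == theta q (k%:Z - n%:Z + i%:Z - 1)).
rewrite cF dL => <-.
have -> : [set v : restrict_scalars V | v != 0 & #|linear_set_in U (vperp v)|%:R
      == theta q (k%:Z - n%:Z + i%:Z - 1)] =
    [set v : restrict_scalars V | v != 0 & \dim (annL U v) == i].
  by apply/setP => v; rewrite !inE thetaE dcap eqn_add2l.
have q0 := natq_neq0 q1; have nroot := natq_nroot q1.
rewrite (qbin_moment_inversion (P := fun v : restrict_scalars V => v != 0)
  q0 nroot dh ih) big_mkord mulr_sumr.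
apply: eq_bigr => j _.
have jh : (j <= h - i)%N by rewrite -ltnS.
have sh : (i + j <= h.+1)%N by lia.
have -> : \sum_(v : restrict_scalars V | v != 0)
      qbin (q%:R : rat) (\dim (annL U v)) (i + j) =
    qbin q%:R n (i + j) * (q%:R ^+ (k * (h - i - j + 1)) - 1).
  have := qffact_moment scU hV rat sh.
  rewrite cF dL dVF dU rn -mulnBl mulnC -mulr_suml => ->.
  by rewrite mulrAC; congr (_ * (_ ^+ (_ * _) - 1)); lia.
rewrite rn -mulnA mulKn // qbinomE // mulrA.
(* For i > n both sides vanish; the trinomial identity needs i <= n. *)
have [ni|le_in] := ltnP n i.
  by rewrite !(@qbin_small _ _ n) ?ltn_addr // !(mulr0, mul0r).
by rewrite subzn // qbinomE // qbin_trinomial //; ring.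
Qed.
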